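(* Let $G$ and $H$ be finite simple graphs with $\operatorname{im}(G)=t$ and $\operatorname{im}(H)=r$. Suppose there is a $K_t$-immersion $I_1$ in $G$ and a $K_r$-immersion $I_2$ in $H$ such that all of the paths between terminals in $I_1$ and in $I_2$ have the same parity (i.e., either every such path in both immersions has an even number of pegs, or every such path in both immersions has an odd number of pegs). Then $\operatorname{im}(G\times H)\geq (t-1)(r-1)+1$.
   Context: All graphs are finite and simple. A graph $G$ has a $G'$-immersion if there is an injective map $\phi:V(G')\to V(G)$ such that for every edge $uv\in E(G')$ there is a path $P_{u,v}$ in $G$ joining $\phi(u)$ and $\phi(v)$, and these paths are pairwise edge-disjoint. The vertices $\phi(v)$ are the terminals of the immersion, and the internal vertices of the paths $P_{u,v}$ are its pegs (so the number of pegs on a path is its length minus one). The immersion number $\operatorname{im}(G)$ is the largest $t$ such that $G$ has a $K_t$-immersion. The direct product $G\times H$ has vertex set $V(G)\times V(H)$, with $(g,h)$ adjacent to $(g',h')$ if and only if $gg'\in E(G)$ and $hh'\in E(H)$. *)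

(* Defs.v *)
From mathcomp Require Import all_boot.
From mathcomp Require Import boolp.

Set Implicit Arguments.
Unset Strict Implicit.
Unset Printing Implicit Defensive.

Record sgraph := SGraph {
  svertex :> finType;
  adj : rel svertex;
  adj_sym : symmetric adj;
  adj_irrefl : irreflexive adj
}.

Definition edges (G : sgraph) : {set {set G}} :=
  [set A : {set G} | [exists x, exists y, adj x y && (A == [set x; y])]].

Section Complete.
Variable t : nat.
Definition complete_rel : rel 'I_t := fun x y => x != y.
Lemma complete_sym : symmetric complete_rel.
Proof. by move=> x y; rewrite /complete_rel eq_sym. Qed.
Lemma complete_irrefl : irreflexive complete_rel.
Proof. by move=> x; rewrite /complete_rel eqxx. Qed.
Definition complete : sgraph := SGraph complete_sym complete_irrefl.
End Complete.

Section DirectProduct.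
Variables G H : sgraph.
Definition dprod_rel : rel (G * H)%type :=
  fun p q => adj p.1 q.1 && adj p.2 q.2.
Lemma dprod_sym : symmetric dprod_rel.
Proof. by move=> p q; rewrite /dprod_rel !(adj_sym p.1) !(adj_sym p.2). Qed.
Lemma dprod_irrefl : irreflexive dprod_rel.
Proof. by move=> p; rewrite /dprod_rel adj_irrefl. Qed.
Definition dprod : sgraph := SGraph dprod_sym dprod_irrefl.
End DirectProduct.

(* A path is given by the sequence of all its vertices, both ends included. *)
Definition is_path (G : sgraph) (x y : G) (s : seq G) : bool :=
  if s is z :: p then
    [&& z == x, path (@adj G) z p, last z p == y & uniq (z :: p)]
  else false.

Definition joins (G : sgraph) (x y : G) (s : seq G) : bool :=
  is_path x y s || is_path y x s.

Definition path_edges (G : sgraph) (s : seq G) : {set {set G}} :=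
  [set [set p.1; p.2] | p in zip s (behead s)].

Definition pegs (G : sgraph) (s : seq G) : seq G :=
  if s is x :: p then behead (belast x p) else [::].

(* Routes are indexed by unordered edges of F; the
   value of [route] on sets that are not edges of F is irrelevant. *)
Record immersion (F G : sgraph) := Immersion {
  terminal : F -> G;
  route : {set F} -> seq G;
  terminal_inj : injective terminal;
  route_joins : forall u v : F, adj u v ->
    joins (terminal u) (terminal v) (route [set u; v]);
  route_disjoint : forall A B : {set F},
    A \in edges F -> B \in edges F -> A != B ->
    [disjoint path_edges (route A) & path_edges (route B)]
}.

Definition has_immersion (F G : sgraph) : Prop := inhabited (immersion F G).

Definition has_clique_immersion (G : sgraph) : pred nat :=
  fun t => `[< has_immersion (complete t) G >].

Lemma clique_immersion_ex (G : sgraph) : exists t, has_clique_immersion G t.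
Proof.
exists 0; apply/asboolP; constructor.
have K0 (x : complete 0) : False by case: x.
apply: (@Immersion _ _ (fun x => False_rect _ (K0 x)) (fun=> [::])).
- by move=> x; case: (K0 x).
- by move=> x; case: (K0 x).
- by move=> A B; rewrite inE => /existsP[x]; case: (K0 x).
Qed.

Lemma clique_immersion_le (G : sgraph) (t : nat) :
  has_clique_immersion G t -> t <= #|G|.
Proof.
move=> /asboolP[I]; have := max_card (mem (codom (terminal I))).
by rewrite (card_codom (@terminal_inj _ _ I)) card_ord.
Qed.

Definition im (G : sgraph) : nat :=
  ex_maxn (clique_immersion_ex G) (@clique_immersion_le G).

Definition all_even_pegs (F G : sgraph) (I : immersion F G) : Prop :=
  forall A, A \in edges F -> ~~ odd (size (pegs (route I A))).

Definition all_odd_pegs (F G : sgraph) (I : immersion F G) : Prop :=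
  forall A, A \in edges F -> odd (size (pegs (route I A))).

(* Main.v *)
(* Immersions compose, so two facts suffice.

   First, [F1 x F2] immerses in [G1 x G2] when all routes of the two immersions
   have lengths of one parity.  For a route [P] of length [p] and a route [Q] of
   length [q >= p], go along [Q] while going along [P] and then bouncing on its
   last edge; reflecting the first coordinate gives the second diagonal of
   [P x Q].  The two walks never use the same edge, since an edge changes the
   first coordinate by one and so cannot have both ends on the axis of the
   reflection.

   Second, [K_(s m + 1)] immerses in [K_(s+1) x K_(m+1)].  The terminals are
   (0, 0) and the (i, j) with [i, j > 0].  Those in different rows and columns
   are adjacent.  The terminals (i, j) and (i, j') of a row are joined through
   (0, f j j'), those of a column, (i, j) and (i', j), through (f i i', 0), with
   [f] a symmetric idempotent Latin square.  In even order no such [f] exists, but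
   there is one whose symmetry fails only at antipodal pairs.  These are joined
   through the pegs of the other kind if [s] and [m] are both even, and by a path
   (i, j), (f i i', 0), (0, j), (f i' i, 0), (i', j) if only [s] is even. *)

Require Import Defs.
From mathcomp Require Import all_boot.
From mathcomp Require Import boolp zify.

Set Implicit Arguments.
Unset Strict Implicit.
Unset Printing Implicit Defensive.

(** * Edges of paths, and immersions from edge ownership *)

Lemma set2_eqP (T : finType) (a b c d : T) :
  [set a; b] = [set c; d] -> (a = c /\ b = d) \/ (a = d /\ b = c).
Proof.
move=> E.
have: a \in [set c; d] by rewrite -E set21.
have: b \in [set c; d] by rewrite -E set22.
have: c \in [set a; b] by rewrite E set21.
have: d \in [set a; b] by rewrite E set22.
by rewrite !inE; do 4![case/orP=> /eqP ?]; subst; auto.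
Qed.

Lemma imset_set2 (T U : finType) (f : T -> U) (a b : T) :
  f @: [set a; b] = [set f a; f b].
Proof. by rewrite imsetU !imset_set1. Qed.

Lemma mem_edges (G : sgraph) (x y : G) : adj x y -> [set x; y] \in edges G.
Proof.
by move=> xy; rewrite inE; apply/existsP; exists x; apply/existsP; exists y;
  rewrite xy eqxx.
Qed.

Lemma edgesP (G : sgraph) (A : {set G}) :
  A \in edges G -> exists x y, adj x y /\ A = [set x; y].
Proof.
by rewrite inE => /existsP[x /existsP[y /andP[xy /eqP->]]]; exists x, y.
Qed.

Lemma adj_neq (G : sgraph) (x y : G) : adj x y -> x != y.
Proof. by apply: contraTneq => ->; rewrite adj_irrefl. Qed.

Lemma path_edges_cons (G : sgraph) (x y : G) (s : seq G) :
  path_edges (x :: y :: s) = [set x; y] |: path_edges (y :: s).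
Proof.
apply/setP=> E; rewrite !inE; apply/imsetP/orP => /= [[p]|].
  rewrite inE => /orP[/eqP-> ->|ps ->]; first by left.
  by right; apply/imsetP; exists p.
case=> [/eqP->|/imsetP[p ps ->]]; first by exists (x, y) => //; rewrite inE eqxx.
by exists p => //; rewrite inE ps orbT.
Qed.

Lemma path_edgesP (G : sgraph) (R : rel G) (x : G) (s : seq G) (E : {set G}) :
  path R x s -> E \in path_edges (x :: s) -> exists a b, R a b /\ E = [set a; b].
Proof.
elim: s x => [|y s IHs] x /=; first by move=> _ /imsetP[].
case/andP=> Rxy ps; rewrite path_edges_cons !inE => /orP[/eqP->|]; last exact: IHs.
by exists x, y.
Qed.

Lemma path_edges_connect (G : sgraph) (x : G) (s : seq G) (S : {set {set G}}) :
  path (@adj G) x s -> {subset path_edges (x :: s) <= S} ->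
  connect [rel a b | adj a b && ([set a; b] \in S)] x (last x s).
Proof.
elim: s x => [|y s IHs] x /=; first by rewrite connect0.
case/andP=> xy ps; rewrite path_edges_cons => sub.
apply: (connect_trans (connect1 _) (IHs y ps _)).
  by rewrite /= xy sub // !inE eqxx.
by move=> E Es; apply: sub; rewrite !inE Es orbT.
Qed.

Lemma nth_path_edges (G : sgraph) (x0 : G) (s : seq G) (i : nat) :
  i.+1 < size s -> [set nth x0 s i; nth x0 s i.+1] \in path_edges s.
Proof.
elim: s i => [|x [|y s] IHs] [|i] // lt_i; rewrite path_edges_cons !inE ?eqxx //.
by rewrite IHs ?orbT.
Qed.

Lemma adj_set_sym (G : sgraph) (S : {pred {set G}}) :
  symmetric [rel a b : G | adj a b && ([set a; b] \in S)].
Proof. by move=> a b /=; rewrite adj_sym setUC. Qed.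

(** Connectivity inside the edge set of a route is symmetric, so the direction in which the route is
    stored does not matter. *)
Lemma route_connect (F G : sgraph) (I : immersion F G) (u v : F) : adj u v ->
  connect [rel a b | adj a b && ([set a; b] \in path_edges (route I [set u; v]))]
    (terminal I u) (terminal I v).
Proof.
move=> uv; have sym := sym_connect_sym (adj_set_sym (mem (path_edges (route I [set u; v])))).
case/orP: (route_joins I uv); case: (route I _) sym => // z s sym /=;
  case/and4P=> /eqP<- ps /eqP<- _; last rewrite sym; exact: path_edges_connect.
Qed.

(* It suffices to give each edge of [F] a set of edges of [G] that connects
   the two terminals, provided no edge of [G] is given away twice. *)
Lemma immersion_of_ownership (F G : sgraph) (tm : F -> G)
    (W : F -> F -> {pred {set G}}) :
  injective tm ->
  (forall u v, adj u v ->
    connect [rel a b | adj a b && ([set a; b] \in W u v)] (tm u) (tm v)) ->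
  (forall u v u' v' E, adj u v -> adj u' v' ->
    E \in W u v -> E \in W u' v' -> [set u; v] = [set u'; v']) ->
  has_immersion F G.
Proof.
move=> tm_inj W_conn W_uniq.
have route_ex u v : adj u v -> exists s, is_path (tm u) (tm v) s /\
    {subset path_edges s <= W u v}.
  move=> uv; have /connectP[s0 + ->] := W_conn _ _ uv.
  case/shortenP=> s ps us _; exists (tm u :: s); split; last first.
    by move=> E /(path_edgesP ps)[a [b [/andP[_ ?] ->]]].
  apply/and4P; split=> //; apply: sub_path ps => a b; by case/andP.
have /choice[rt rtP] (A : {set F}) : exists s, A \in edges F -> exists u v,
    [/\ adj u v, A = [set u; v], is_path (tm u) (tm v) s
      & {subset path_edges s <= W u v}].
  have [/edgesP[u [v [uv ->]]]|_] := boolP (A \in edges F); last by exists [::].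
  by have [s [ps sW]] := route_ex _ _ uv; exists s => _; exists u, v.
constructor; apply: (@Immersion _ _ tm rt tm_inj).
  move=> u v uv; have [u' [v' [_ E ps _]]] := rtP _ (mem_edges uv).
  by rewrite /joins; case: (set2_eqP E) ps => -[-> ->] ->; rewrite ?orbT.
move=> A B eA eB; apply: contraR => /pred0Pn[E /andP[/= EA EB]]; apply/eqP.
have [u [v [uv defA _ sA]]] := rtP _ eA; have [u' [v' [uv' defB _ sB]]] := rtP _ eB.
rewrite defA defB; exact: W_uniq uv uv' (sA _ EA) (sB _ EB).
Qed.

Lemma immersion_of_hom (F G : sgraph) (f : F -> G) :
  injective f -> {homo f : u v / adj u v} -> has_immersion F G.
Proof.
move=> f_inj f_hom.
apply: (@immersion_of_ownership _ _ f (fun u v => pred1 (f @: [set u; v]))) => //.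
  by move=> u v uv; apply: connect1; rewrite /= f_hom //= inE imset_set2.
move=> u v u' v' E _ _ /eqP-> /eqP; exact: (imset_inj f_inj).
Qed.

Lemma connect_map (T U : finType) (e : rel T) (e' : rel U) (f : T -> U) x y :
  (forall a b, e a b -> connect e' (f a) (f b)) ->
  connect e x y -> connect e' (f x) (f y).
Proof.
move=> ee' /connectP[s + ->]; elim: s x => //= z s IHs x /andP[xz zs].
exact: connect_trans (ee' _ _ xz) (IHs _ zs).
Qed.

(** Substitute [J]-routes for the edges of each [I]-route. An edge of [H] lies on the [J]-route of
    only one edge of [G], which in turn lies on only one [I]-route. Repeated vertices are harmless,
    since ownership asks only for connectivity. *)
Lemma has_immersion_trans (F G H : sgraph) :
  has_immersion F G -> has_immersion G H -> has_immersion F H.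
Proof.
move=> [I] [J].
pose W u v := [pred E | [exists A in edges G,
  (A \in path_edges (route I [set u; v])) && (E \in path_edges (route J A))]].
apply: (@immersion_of_ownership _ _ (terminal J \o terminal I) W).
- exact: inj_comp (@terminal_inj _ _ J) (@terminal_inj _ _ I).
- move=> u v uv; apply: connect_map (route_connect I uv) => a b /andP[ab abI].
  apply: (connect_sub _ (route_connect J ab)) => c d /andP[cd cdJ].
  apply: connect1; rewrite /= cd inE /=; apply/existsP; exists [set a; b].
  by rewrite mem_edges // abI.
- move=> u v u' v' E uv uv' /existsP[A /and3P[eA AI EJ]] /existsP[B /and3P[eB BI EJ']].
  have [AB|AB] := eqVneq A B; last first.
    by rewrite (disjointFr (route_disjoint J eA eB AB) EJ) in EJ'.
  rewrite -{}AB in BI; apply/eqP; apply: contraT => ne.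
  by rewrite (disjointFr (route_disjoint I (mem_edges uv) (mem_edges uv') ne) AI) in BI.
Qed.

Lemma leq_im (G : sgraph) (n : nat) : has_immersion (complete n) G -> n <= im G.
Proof.
by move=> I; rewrite /im; case: ex_maxnP => m _; apply; apply/asboolP.
Qed.

Lemma im_gt0 (G : sgraph) : 0 < #|G| -> 0 < im G.
Proof.
case/card_gt0P=> x _; apply: leq_im; apply: (@immersion_of_hom _ _ (fun=> x)).
  by move=> u v _; rewrite (ord1 u) (ord1 v).
by move=> u v; rewrite (ord1 u) (ord1 v) adj_irrefl.
Qed.

(** * Products of immersions through the two diagonals of a product of paths *)

Lemma connect_nat (T : finType) (R : rel T) (w : nat -> T) (n : nat) :
  (forall i, i < n -> R (w i) (w i.+1)) -> connect R (w 0) (w n).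
Proof.
elim: n => [|n IHn] Rw; first exact: connect0.
apply: connect_trans (IHn _) (connect1 (Rw _ _)) => // i lt_i.
exact: Rw (leqW lt_i).
Qed.

(** The predicate [c] two-colours the edges of the product; keeping each diagonal inside its own
    colour [b] makes the two edge-disjoint. *)
Definition diagonal_rel (G H : sgraph) (P : seq G) (Q : seq H)
    (c : {set G * H} -> bool) (b : bool) : rel (G * H)%type :=
  [rel e e' : G * H | dprod_rel e e' && [&& [set e.1; e'.1] \in path_edges P,
     [set e.2; e'.2] \in path_edges Q & c [set e; e'] == b]].

(* The position after [n] steps of a walk that goes from one end of a path of
   length [p] to the other and then bounces on the last edge. *)
Definition bounce (p n : nat) := if n <= p then n else p - odd (n - p).

Lemma bounce_le p n : bounce p n <= p.
Proof. by rewrite /bounce; case: ifP => //; rewrite leq_subr. Qed.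

Lemma bounce_end p n : p <= n -> odd p = odd n -> bounce p n = p.
Proof. by rewrite /bounce; case: ifP; lia. Qed.

Lemma bounceS p n : 0 < p ->
  (bounce p n.+1 = (bounce p n).+1) \/ (bounce p n = (bounce p n.+1).+1).
Proof. by rewrite /bounce; do 2!case: ifP; lia. Qed.

Lemma is_pathP (G : sgraph) (x y : G) (s : seq G) : is_path x y s ->
  [/\ 0 < size s, nth x s 0 = x, nth x s (size s).-1 = y, uniq s
    & forall i, i.+1 < size s -> adj (nth x s i) (nth x s i.+1)].
Proof.
case: s => //= z s /and4P[/eqP-> ps /eqP<- us]; split=> //.
  by rewrite -last_nth.
by move=> i lt_i; exact: (pathP x ps).
Qed.

Lemma diagonals_le (G H : sgraph) (a b : G) (x y : H) (P : seq G) (Q : seq H) :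
  a != b -> is_path a b P -> is_path x y Q ->
  odd (size P) = odd (size Q) -> size P <= size Q ->
  exists c, connect (diagonal_rel P Q c true) (a, x) (b, y) /\
            connect (diagonal_rel P Q c false) (b, x) (a, y).
Proof.
move=> ab /is_pathP[P0 Pa Pb uP adP] /is_pathP[Q0 Qx Qy uQ adQ] oPQ lePQ.
set p := (size P).-1 in Pb; set q := (size Q).-1 in Qy.
have sP : size P = p.+1 by rewrite prednK.
have sQ : size Q = q.+1 by rewrite prednK.
have p0 : 0 < p by move: ab; rewrite -Pa -Pb; case: (p) => //; rewrite eqxx.
have pq : p <= q by lia.
have opq : odd p = odd q by lia.
pose flip d i := if d then i else p - i.
pose w d n : G * H := (nth a P (flip d (bounce p n)), nth x Q n).
have fl d n : flip d (bounce p n) < size P.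
  by have := bounce_le p n; rewrite /flip; case: d; lia.
(* Colour [true] marks the edges of the first walk; the reflected walk has to avoid them. *)
pose c E := [exists n : 'I_q, E == [set w true n; w true n.+1]].
have step d n : n < q ->
    dprod_rel (w d n) (w d n.+1) && [&& [set (w d n).1; (w d n.+1).1] \in path_edges P,
    [set (w d n).2; (w d n.+1).2] \in path_edges Q & c [set w d n; w d n.+1] == d].
  move=> nq; have nQ : n.+1 < size Q by rewrite sQ.
  have := fl d n; have := fl d n.+1; have [le1 le2] := (bounce_le p n, bounce_le p n.+1).
  have [adPf memPf] : adj (w d n).1 (w d n.+1).1 /\
      [set (w d n).1; (w d n.+1).1] \in path_edges P.
    have [E|E] : flip d (bounce p n.+1) = (flip d (bounce p n)).+1 \/
        flip d (bounce p n) = (flip d (bounce p n.+1)).+1.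
      by have := bounceS n p0; rewrite /flip; case: (d); lia.
    - by rewrite /= E adP ?nth_path_edges // -E.
    - by rewrite /= E adj_sym setUC adP ?nth_path_edges // -E.
  rewrite memPf /dprod_rel adPf adQ //= nth_path_edges //= => lt1 lt2.
  apply/eqP; case: d {adPf memPf} lt1 lt2 => lt1 lt2.
    by apply/existsP; exists (Ordinal nq).
  (* The second coordinates force a common edge to be used at the same time [n = m] and in the same
     direction. The reflection then fixes both [bounce p n] and [bounce p n.+1], which differ by
     one. *)
  apply/existsP=> -[[m mq] /= /eqP/set2_eqP].
  have eqw d' k k' : k <= q -> k' <= q -> w false k = w d' k' ->
      k = k' /\ p - bounce p k = flip d' (bounce p k').
    move=> kq kq' [/eqP E1 /eqP E2]; move: E1 E2.
    rewrite !nth_uniq ?fl ?sQ //; first by move=> /eqP-> /eqP->.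
    by have := fl false k.
  case=> -[/eqw E1 /eqw E2].
    have {E1}[|//|? E1] := E1; first exact: ltnW.
      exact: ltnW.
    have {E2}[//|//|_ E2] := E2; subst m; move: E1 E2.
    by have := bounceS n p0; rewrite /flip; lia.
  have {E1}[|//|? E1] := E1; first exact: ltnW.
  have {E2}[//||? E2] := E2; first exact: ltnW.
  lia.
exists c; split.
  have := @connect_nat _ (diagonal_rel P Q c true) (w true) q (step true).
  by rewrite /w /flip (bounce_end pq opq) /bounce leq0n Pa Qx Qy Pb.
have := @connect_nat _ (diagonal_rel P Q c false) (w false) q (step false).
by rewrite /w /flip (bounce_end pq opq) /bounce leq0n subnn subn0 Pa Qx Qy Pb.
Qed.

Lemma diagonal_rel_sym (G H : sgraph) (P : seq G) (Q : seq H) c b :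
  symmetric (diagonal_rel P Q c b).
Proof.
by move=> e e'; rewrite /diagonal_rel /= dprod_sym [[set e; _]]setUC [[set e.1; _]]setUC [[set e.2; _]]setUC.
Qed.

Lemma diagonals (G H : sgraph) (a b : G) (x y : H) (P : seq G) (Q : seq H) :
  a != b -> x != y -> is_path a b P -> is_path x y Q ->
  odd (size P) = odd (size Q) ->
  exists c, connect (diagonal_rel P Q c true) (a, x) (b, y) /\
            connect (diagonal_rel P Q c false) (b, x) (a, y).
Proof.
move=> ab xy pP pQ oPQ; have [le_PQ|lt_QP] := leqP (size P) (size Q).
  exact: diagonals_le ab pP pQ oPQ le_PQ.
(* With [Q] the shorter path the factors trade places. This reverses the second diagonal, which
   symmetry repairs. *)
have [c [c1 c2]] := diagonals_le xy pQ pP (esym oPQ) (ltnW lt_QP).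
pose sw (e : H * G) := (e.2, e.1); pose ws (e : G * H) := (e.2, e.1).
exists (fun E : {set G * H} => c (ws @: E)).
have sw_rel d e e' : diagonal_rel Q P c d e e' ->
    connect (diagonal_rel P Q (fun E : {set G * H} => c (ws @: E)) d) (sw e) (sw e').
  case: e e' => [h g] [h' g'] /and4P[/andP[/= hh gg] /= hQ gP cE]; apply: connect1.
  by rewrite /diagonal_rel /= /dprod_rel /= hh gg hQ gP imset_set2.
split; first exact: (connect_map (sw_rel true) c1).
by rewrite (sym_connect_sym (@diagonal_rel_sym _ _ _ _ _ _)); exact: (connect_map (sw_rel false) c2).
Qed.

(** Routes belong to unordered edges; their orientation is needed to tell the two diagonals over a
    pair of edges apart. *)
Definition route_forward (F G : sgraph) (I : immersion F G) (a b : F) : bool :=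
  is_path (terminal I a) (terminal I b) (route I [set a; b]).

Lemma route_forwardC (F G : sgraph) (I : immersion F G) (a b : F) :
  adj a b -> route_forward I b a = ~~ route_forward I a b.
Proof.
move=> ab; have := route_joins I ab; rewrite /joins /route_forward [[set b; a]]setUC.
have [] := boolP (is_path _ _ _) => //=; case: (route I _) => //= z s /and4P[/eqP-> _ _ _] _.
by rewrite (inj_eq (@terminal_inj _ _ I)) (negPf (adj_neq ab)).
Qed.

Lemma edge_forward (F G : sgraph) (I : immersion F G) (A : {set F}) :
  A \in edges F -> exists a b, [/\ adj a b, route_forward I a b & A = [set a; b]].
Proof.
case/edgesP=> a [b [ab ->]]; have [fab|nfab] := boolP (route_forward I a b).
  by exists a, b.
by exists b, a; rewrite setUC adj_sym ab route_forwardC.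
Qed.

(** Over an edge of [F1] and an edge of [F2] lie exactly two edges of the product, the diagonals.
    Whether the two orientations agree tells which one is meant, and this is unchanged when both
    ends are swapped. *)
Lemma dprod_has_immersion (F1 F2 G1 G2 : sgraph)
    (I1 : immersion F1 G1) (I2 : immersion F2 G2) :
  (forall A B, A \in edges F1 -> B \in edges F2 ->
    odd (size (route I1 A)) = odd (size (route I2 B))) ->
  has_immersion (dprod F1 F2) (dprod G1 G2).
Proof.
move=> parity; pose f1 := route_forward I1; pose f2 := route_forward I2.
pose D (AB : {set F1} * {set F2}) := diagonal_rel (route I1 AB.1) (route I2 AB.2).
have Dsym P Q c b := sym_connect_sym (@diagonal_rel_sym G1 G2 P Q c b).
(* One colouring per pair of unordered edges, so that both diagonals over the pair share it. *)
have /choice[c cP] (AB : {set F1} * {set F2}) : exists c, forall a b x y,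
    adj a b -> adj x y -> AB = ([set a; b], [set x; y]) ->
    connect (D AB c (f1 a b == f2 x y)) (terminal I1 a, terminal I2 x)
      (terminal I1 b, terminal I2 y).
  case: AB => A B; have [eA|nA] := boolP (A \in edges F1); last first.
    by exists xpredT => a b x y ab _ [defA _]; rewrite defA mem_edges in nA.
  have [eB|nB] := boolP (B \in edges F2); last first.
    by exists xpredT => a b x y _ xy [_ defB]; rewrite defB mem_edges in nB.
  have [a0 [b0 [ab0 fab0 defA]]] := edge_forward I1 eA.
  have [x0 [y0 [xy0 fxy0 defB]]] := edge_forward I2 eB.
  have [|||||c [c1 c2]] := @diagonals _ _ (terminal I1 a0) (terminal I1 b0)
    (terminal I2 x0) (terminal I2 y0) (route I1 A) (route I2 B).
  - by rewrite (inj_eq (@terminal_inj _ _ I1)) adj_neq.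
  - by rewrite (inj_eq (@terminal_inj _ _ I2)) adj_neq.
  - by rewrite defA.
  - by rewrite defB.
  - exact: parity.
  exists c => a b x y ab xy []; rewrite {1}defA {1}defB => /set2_eqP defab /set2_eqP defxy.
  have [fba0 fyx0] := (route_forwardC I1 ab0, route_forwardC I2 xy0).
  rewrite /D /= /f1 /f2.
  by case: defab => -[<- <-]; case: defxy => -[<- <-];
    rewrite ?fba0 ?fyx0 ?fab0 ?fxy0 //= Dsym.
pose W (u v : F1 * F2) := [pred E : {set G1 * G2} |
  [&& fst @: E \in path_edges (route I1 [set u.1; v.1]),
      snd @: E \in path_edges (route I2 [set u.2; v.2])
    & c ([set u.1; v.1], [set u.2; v.2]) E == (f1 u.1 v.1 == f2 u.2 v.2)]].
apply: (@immersion_of_ownership (dprod F1 F2) (dprod G1 G2)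
  (fun u => (terminal I1 u.1, terminal I2 u.2)) W).
- by move=> [a x] [b y] [/(@terminal_inj _ _ I1)-> /(@terminal_inj _ _ I2)->].
- move=> [a x] [b y] /andP[/= ab xy]; have := cP (_, _) _ _ _ _ ab xy erefl.
  apply: connect_sub => e e' /and4P[ee' eP eQ cE]; apply: connect1.
  by rewrite /= ee' inE /= !imset_set2 eP eQ.
- move=> [a x] [b y] [a' x'] [b' y'] E /andP[/= ab xy] /andP[/= ab' xy'].
  move=> /and3P[/= Ea Ex /eqP Ec] /and3P[/= Ea' Ex' /eqP Ec'].
  have eqA : [set a; b] = [set a'; b'].
    apply/eqP; apply: contraT => ne.
    by rewrite (disjointFr (route_disjoint I1 (mem_edges ab) (mem_edges ab') ne) Ea) in Ea'.
  have eqB : [set x; y] = [set x'; y'].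
    apply/eqP; apply: contraT => ne.
    by rewrite (disjointFr (route_disjoint I2 (mem_edges xy) (mem_edges xy') ne) Ex) in Ex'.
  rewrite -eqA -eqB Ec {Ec} in Ec'.
  have [fba fyx] := (route_forwardC I1 ab, route_forwardC I2 xy).
  (* Swapping the ends in just one factor would flip the colour. *)
  move: Ec'; case: (set2_eqP eqA) => -[<- <-]; case: (set2_eqP eqB) => -[<- <-] //.
  + by rewrite /f1 /f2 fyx; case: (route_forward _ _ _); case: (route_forward _ _ _).
  + by rewrite /f1 /f2 fba; case: (route_forward _ _ _); case: (route_forward _ _ _).
  + by rewrite setUC.
Qed.

Lemma odd_pegs (G : sgraph) (s : seq G) : 1 < size s -> odd (size (pegs s)) = odd (size s).
Proof. by case: s => [|x [|y s]] //= _; rewrite size_belast negbK. Qed.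

Lemma size_route (F G : sgraph) (I : immersion F G) (A : {set F}) :
  A \in edges F -> 1 < size (route I A).
Proof.
case/(edge_forward I)=> a [b [ab + ->]]; rewrite /route_forward.
case: (route I _) => [|z [|z' s]] // /and4P[/eqP-> _ /eqP E _].
by move: (adj_neq ab); rewrite (terminal_inj E) eqxx.
Qed.

Lemma dprod_has_immersion_pegs (F1 F2 G1 G2 : sgraph)
    (I1 : immersion F1 G1) (I2 : immersion F2 G2) :
  (all_even_pegs I1 /\ all_even_pegs I2) \/ (all_odd_pegs I1 /\ all_odd_pegs I2) ->
  has_immersion (dprod F1 F2) (dprod G1 G2).
Proof.
move=> same; apply: (@dprod_has_immersion _ _ _ _ I1 I2) => A B eA eB.
rewrite -(odd_pegs (size_route I1 eA)) -(odd_pegs (size_route I2 eB)).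
by case: same => -[/(_ A eA) + /(_ B eB)]; do 2!case: (odd _).
Qed.

(** * Immersing a clique in a product of two cliques *)

Section Clique.
Variable T : finType.
(** Arbitrary finite vertex types let [None] play the vertex 0 and pairs name the other
    terminals. *)
Definition clique_rel : rel T := fun x y => x != y.
Lemma clique_sym : symmetric clique_rel.
Proof. by move=> x y; rewrite /clique_rel eq_sym. Qed.
Lemma clique_irrefl : irreflexive clique_rel.
Proof. by move=> x; rewrite /clique_rel eqxx. Qed.
Definition clique : sgraph := SGraph clique_sym clique_irrefl.
End Clique.

(* [g u v] is the neighbour through which the route from [u] to [v] leaves
   [u]; [X u v] owns the edges of that route not incident with a terminal. *)
Lemma clique_immersion_of_pegs (T : finType) (L : sgraph) (tm : T -> L)
    (g : T -> T -> L) (X : T -> T -> {pred {set L}}) :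
  injective tm ->
  (forall u v, u != v -> adj (tm u) (g u v)) ->
  (forall u v v', u != v -> u != v' -> g u v = g u v' -> v = v') ->
  (forall u v w, u != v -> g u v = tm w -> w = v) ->
  (forall u v, u != v -> g u v != tm v ->
    connect [rel a b | adj a b && ([set a; b] \in X u v)] (g u v) (g v u)) ->
  (forall u v w E, E \in X u v -> tm w \notin E) ->
  (forall u v u' v' E, u != v -> u' != v' -> E \in X u v -> E \in X u' v' ->
    [set u; v] = [set u'; v']) ->
  has_immersion (clique T) L.
Proof.
move=> tm_inj g_adj g_inj g_tm g_conn X_tm X_uniq.
pose W u v := [pred E | [|| E == [set tm u; g u v], E == [set tm v; g v u] | E \in X u v]].
have end_uniq u v u' v' : u != v -> u' != v' ->
    [set tm u; g u v] = [set tm u'; g u' v'] -> [set u; v] = [set u'; v'].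
  move=> uv uv' /set2_eqP[] [E1 E2].
    by move/tm_inj: E1 => E1; subst u'; rewrite (g_inj _ _ _ uv uv' E2).
  (* Crossed case: both pegs are terminals, hence the far ends of their routes. *)
  by rewrite (g_tm _ _ _ uv' (esym E1)) (g_tm _ _ _ uv E2) setUC.
apply: (@immersion_of_ownership (clique T) _ tm W) => // u v.
  move=> uv; have vu : v != u by rewrite eq_sym.
  have step1 : connect [rel a b | adj a b && ([set a; b] \in W u v)] (tm u) (g u v).
    by apply: connect1; rewrite /= g_adj // inE /= eqxx.
  have [E|ne] := eqVneq (g u v) (tm v); first by rewrite -E.
  apply: connect_trans step1 (connect_trans (y := g v u) _ _).
    apply: (connect_sub _ (g_conn _ _ uv ne)) => a b /andP[ab abX].
    by apply: connect1; rewrite /= ab inE /= abX !orbT.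
  by apply: connect1; rewrite /= adj_sym g_adj // inE /= [[set g v u; _]]setUC eqxx orbT.
move=> u' v' E uv uv'; have vu : v != u by rewrite eq_sym.
have vu' : v' != u' by rewrite eq_sym.
case/or3P=> [/eqP->|/eqP->|EX]; case/or3P=> [/eqP|/eqP|].
- exact: end_uniq.
- by rewrite [[set u'; v']]setUC; exact: end_uniq.
- by move/(X_tm _ _ u); rewrite set21.
- by rewrite [[set u; v]]setUC; exact: end_uniq.
- by rewrite [[set u; v]]setUC [[set u'; v']]setUC; exact: end_uniq.
- by move/(X_tm _ _ v); rewrite set21.
- by move=> defE; move/(X_tm _ _ u'): EX; rewrite defE set21.
- by move=> defE; move/(X_tm _ _ v'): EX; rewrite defE set21.
- exact: X_uniq.
Qed.

(* A symmetric idempotent Latin square, given off the diagonal, whose symmetry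
   may fail at the pairs of a matching [p]; the fixed points of [p] are unmatched. *)
Definition matched_square (S : finType) (f : S -> S -> S) (p : S -> S) : Prop :=
  [/\ involutive p,
      forall i j, i != j -> f i j != i,
      forall i j j', i != j -> i != j' -> f i j = f i j' -> j = j',
      forall i j, i != j -> j != p i -> f i j = f j i
    & forall i j, p i != i -> p j != j -> f i (p i) = f j (p j) -> i = j].

Section CliqueProduct.
Variables S M : finType.
Variables (fS : S -> S -> S) (pS : S -> S) (fM : M -> M -> M) (pM : M -> M).
Hypotheses (sqS : matched_square fS pS) (sqM : matched_square fM pM).
(** [e] selects the case where neither matching has a fixed point; otherwise [pM] is the identity
    and symmetry can fail only in [fS]. *)
Variable e : bool.
Hypothesis parity : if e then (forall i, pS i != i) /\ (forall j, pM j != j)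
  else forall j, pM j = j.

Let L := dprod (clique (option S)) (clique (option M)).
Let T := option (S * M).

Definition product_terminal (u : T) : L :=
  if u is Some (i, j) then (Some i, Some j) else (None, None).

(** Under [e], the row and column routes from (i, j) to its two antipodal partners exchange pegs.
    The row route gets a peg independent of [j], hence the same from both ends; likewise for
    columns. *)
Definition row_peg (i : S) (j j' : M) : L :=
  if e && (j' == pM j) then (Some (fS i (pS i)), None) else (None, Some (fM j j')).

Definition column_peg (j : M) (i i' : S) : L :=
  if e && (i' == pS i) then (None, Some (fM j (pM j))) else (Some (fS i i'), None).

Definition product_peg (u v : T) : L :=
  match u, v with
  | Some (i, j), Some (i', j') =>
    if i == i' then row_peg i j j' else
    if j == j' then column_peg j i i' else product_terminal v
  | _, _ => product_terminal v
  end.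

Definition inner_edge (k : S) (j : M) : {set L} := [set (Some k, None); (None, Some j)].

(** The two middle edges of the four-edge path between antipodal terminals of a column; all other
    routes consist of edges at terminals. *)
Definition inner_edges (u v : T) : {pred {set L}} :=
  [pred E | match u, v with
  | Some (i, j), Some (i', j') =>
    [&& ~~ e, i' == pS i, j == j' &
        (E == inner_edge (fS i i') j) || (E == inner_edge (fS i' i) j)]
  | _, _ => false
  end].

Lemma product_terminal_inj : injective product_terminal.
Proof. by move=> [[i j]|] [[i' j']|] //= [-> ->]. Qed.

Lemma product_peg_adj u v : u != v -> adj (product_terminal u) (product_peg u v).
Proof.
case: sqS sqM => pSK fSn _ _ _ [pMK fMn _ _ _].
case: u v => [[i j]|] [[i' j']|] //= ne.
have [ei|ni] := eqVneq i i'.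
  subst i'; have nj : j != j' by apply: contraNneq ne => ->.
  rewrite /row_peg; case: ifP => [/andP[e1 _]|_]; rewrite /dprod_rel /= /clique_rel ?andbT.
    move: parity; rewrite e1 => -[/(_ i) + _]; rewrite eq_sym => ni.
    by rewrite (inj_eq Some_inj) eq_sym fSn.
  by rewrite (inj_eq Some_inj) eq_sym fMn.
have [ej|nj] := eqVneq j j'.
  rewrite /column_peg; case: ifP => [/andP[e1 _]|_]; rewrite /dprod_rel /= /clique_rel ?andbT.
    move: parity; rewrite e1 => -[_ /(_ j)]; rewrite eq_sym => nj.
    by rewrite (inj_eq Some_inj) eq_sym fMn.
  by rewrite (inj_eq Some_inj) eq_sym fSn.
by rewrite /dprod_rel /= /clique_rel !(inj_eq Some_inj) ni nj.
Qed.

Lemma product_peg_terminal u v w : u != v -> product_peg u v = product_terminal w -> w = v.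
Proof.
case: u v => [[i j]|] [[i' j']|] //= ne; try by case: w => [[k l]|] //= [-> ->].
rewrite /row_peg /column_peg; do 4?case: ifP => _; case: w => [[k l]|] //= [].
by move=> -> ->.
Qed.

Lemma product_peg_inj u v v' :
  u != v -> u != v' -> product_peg u v = product_peg u v' -> v = v'.
Proof.
case: sqS sqM => pSK _ fSi _ _ [pMK _ fMi _ _].
case: u => [[i j]|] ne ne'; last first.
  by case: v v' ne ne' => [[? ?]|] [[? ?]|] //= _ _ [-> ->].
(* An exchanged row peg could only clash with the column peg towards [pS i], which has itself been
   exchanged; [fpM] is the mirror case. *)
have fpS k : e -> i != k -> fS i (pS i) = fS i k -> k = pS i.
  move=> e1 nk /fSi E; apply/esym/E => //.
  by move: parity; rewrite e1 => -[/(_ i) + _]; rewrite eq_sym.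
have fpM k : e -> j != k -> fM j (pM j) = fM j k -> k = pM j.
  move=> e1 nk /fMi E; apply/esym/E => //.
  by move: parity; rewrite e1 => -[_ /(_ j)]; rewrite eq_sym.
case: v v' ne ne' => [[i1 j1]|] [[i2 j2]|] //= ne1 ne2.
- rewrite /row_peg /column_peg.
  have nj1 : i = i1 -> j != j1 by move=> E; apply: contraNneq ne1 => ->; rewrite E.
  have nj2 : i = i2 -> j != j2 by move=> E; apply: contraNneq ne2 => ->; rewrite E.
  case: (eqVneq i i1) => [E1|n1]; case: (eqVneq i i2) => [E2|n2].
  + have [{}nj1 {}nj2] := (nj1 E1, nj2 E2); subst i1 i2.
    case: ifP => [/andP[e1 /eqP->]|_]; case: ifP => [/andP[_ /eqP->]|_] //.
    by case=> /fMi->.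
  + have {}nj1 := nj1 E1; subst i1; case: (eqVneq j j2) => [E|nj].
      case: ifP => [/andP[e1 /eqP E3]|/negbT nE3]; case: ifP => [/andP[e2 /eqP E4]|/negbT nE4] // [].
        by move/fpS=> E5; rewrite E5 // e1 eqxx in nE4.
      by move/esym/fpM=> E5; rewrite E5 // e2 eqxx in nE3.
    by case: ifP.
  + have {}nj2 := nj2 E2; subst i2; case: (eqVneq j j1) => [E|nj].
      case: ifP => [/andP[e1 /eqP E3]|/negbT nE3]; case: ifP => [/andP[e2 /eqP E4]|/negbT nE4] // [].
        by move/fpM=> E5; rewrite E5 // e1 eqxx in nE4.
      by move/esym/fpS=> E5; rewrite E5 // e2 eqxx in nE3.
    by case: ifP.
  + case: (eqVneq j j1) => [E1|nj]; case: (eqVneq j j2) => [E2|nj'].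
    * subst j1 j2.
      case: ifP => [/andP[e1 /eqP->]|_]; case: ifP => [/andP[_ /eqP->]|_] //.
      by case=> /fSi->.
    * by case: ifP.
    * by case: ifP.
    * by case=> -> ->.
- by rewrite /row_peg /column_peg; do 4?case: ifP.
- by rewrite /row_peg /column_peg; do 4?case: ifP.
Qed.

Lemma product_peg_connect u v : u != v -> product_peg u v != product_terminal v ->
  connect [rel a b | adj a b && ([set a; b] \in inner_edges u v)]
    (product_peg u v) (product_peg v u).
Proof.
case: sqS sqM => pSK _ _ fSC _ [pMK _ _ fMC _].
case: u v => [[i j]|] [[i' j']|] //= ne; rewrite ?eqxx //.
rewrite [i' == i]eq_sym [j' == j]eq_sym; case: (eqVneq i i') => [E|ni].
  subst i'; have nj : j != j' by apply: contraNneq ne => ->.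
  move=> _; rewrite /row_peg [j == pM j']eq_sym (can2_eq pMK pMK).
  case: ifP => [|/negbT nE]; first by rewrite connect0.
  rewrite fMC ?connect0 //; apply: contra nE; case: (e) parity => /= [_ //|pM1].
  by rewrite pM1 eq_sym (negPf nj).
case: (eqVneq j j') => [E|nj]; last by rewrite eqxx.
subst j'; move=> _; rewrite /column_peg [i == pS i']eq_sym (can2_eq pSK pSK).
have [Ep|nEp] := eqVneq i' (pS i); last by rewrite andbF fSC ?connect0.
have [e1|ne1] := boolP e; first by rewrite connect0.
(* Only here do the two pegs come from an asymmetric pair without exchange; the vertex (0, j) links
   them. *)
apply: (connect_trans (y := (None, Some j))); apply: connect1.
  by rewrite /= inE /= /inner_edge Ep ne1 !eqxx.
by rewrite /= inE /= /inner_edge Ep ne1 [[set (None, _); _]]setUC !eqxx orbT.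
Qed.

Lemma inner_edges_terminal u v w E : E \in inner_edges u v -> product_terminal w \notin E.
Proof.
rewrite inE; case: u v w => [[i j]|] [[i' j']|] [[k l]|] //=;
  case/and4P=> _ _ _ /orP[] /eqP->; rewrite !inE;
  by apply/orP=> -[] /eqP[].
Qed.

(** An inner edge shows [j] and the value [fS i (pS i)], and by the last clause of [matched_square]
    that value determines [i]. *)
Lemma inner_edges_uniq u v u' v' E : u != v -> u' != v' ->
  E \in inner_edges u v -> E \in inner_edges u' v' -> [set u; v] = [set u'; v'].
Proof.
case: sqS => pSK _ _ _ fSp.
have inner_inj k j k' j' : inner_edge k j = inner_edge k' j' -> k = k' /\ j = j'.
  by case/set2_eqP => -[] [] // -> [->].
have inner_ex x y F : x != y -> F \in inner_edges x y -> exists i j,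
    [/\ pS i != i, F = inner_edge (fS i (pS i)) j & [set x; y] = [set Some (i, j); Some (pS i, j)]].
  rewrite inE; case: x y => [[i j]|] [[i' j']|] //= ne.
  case/and4P=> _ /eqP E1 /eqP E2 FE; subst i' j'.
  have np : pS i != i by apply: contraNneq ne => ->.
  case/orP: FE => /eqP->; first by exists i, j.
  by exists (pS i), j; rewrite pSK eq_sym setUC.
move=> uv uv' /inner_ex[//|i [j [ni -> ->]]] /inner_ex[//|i' [j' [ni' + ->]]].
by case/inner_inj=> /fSp-> // ->.
Qed.

Lemma clique_product_immersion :
  has_immersion (clique (option (S * M))) (dprod (clique (option S)) (clique (option M))).
Proof.
apply: (@clique_immersion_of_pegs _ L product_terminal product_peg inner_edges).
- exact: product_terminal_inj.
- exact: product_peg_adj.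
- exact: product_peg_inj.
- exact: product_peg_terminal.
- exact: product_peg_connect.
- exact: inner_edges_terminal.
- exact: inner_edges_uniq.
Qed.

End CliqueProduct.

(** * Cyclic Latin squares *)

Definition cyc_add (n i d : nat) := if i + d < n then i + d else i + d - n.
(** This is [j - i] modulo [n], the step leading from [i] to [j]; the case split keeps goals
    linear. *)
Definition cyc_sub (n i j : nat) := if i <= j then j - i else n + j - i.

Lemma cyc_add_lt n i d : i < n -> d < n -> cyc_add n i d < n.
Proof. by rewrite /cyc_add; case: ifP; lia. Qed.

Lemma cyc_addI n i d d' :
  i < n -> d < n -> d' < n -> cyc_add n i d = cyc_add n i d' -> d = d'.
Proof. by rewrite /cyc_add; do 2!case: ifP; lia. Qed.

Lemma cyc_addIr n i i' d :
  i < n -> i' < n -> d < n -> cyc_add n i d = cyc_add n i' d -> i = i'.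
Proof. by rewrite /cyc_add; do 2!case: ifP; lia. Qed.

Lemma cyc_subI n i j j' :
  i < n -> j < n -> j' < n -> cyc_sub n i j = cyc_sub n i j' -> j = j'.
Proof. by rewrite /cyc_sub; do 2!case: ifP; lia. Qed.

Lemma cyc_sub_bounds n i j : i < n -> j < n -> i != j -> 0 < cyc_sub n i j < n.
Proof. by rewrite /cyc_sub; case: ifP; lia. Qed.

Lemma cyc_subC n i j : i < n -> j < n -> i != j -> cyc_sub n j i = n - cyc_sub n i j.
Proof. by rewrite /cyc_sub; do 2!case: ifP; lia. Qed.

Lemma cyc_addK n i d : i < n -> d < n -> cyc_sub n i (cyc_add n i d) = d.
Proof. by rewrite /cyc_sub /cyc_add; do 2!case: ifP; lia. Qed.

Lemma cyc_subK n i j : i < n -> j < n -> cyc_add n i (cyc_sub n i j) = j.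
Proof. by rewrite /cyc_sub /cyc_add; do 2!case: ifP; lia. Qed.

Section CyclicSquare.
Variables (n z : nat) (o : nat -> nat).
Hypothesis z_half : z = 0 \/ z + z = n.
Hypothesis o_bounds : forall d, 0 < d < n -> 0 < o d < n.
Hypothesis o_inj : forall d d', 0 < d < n -> 0 < d' < n -> o d = o d' -> d = d'.
(* [o d = d + o (- d)] modulo [n] *)
Hypothesis o_opp : forall d, 0 < d < n -> d != z ->
  o d = d + o (n - d) \/ o d + n = d + o (n - d).

(** The circulant square [i + o (j - i)] modulo [n]. The default of [insubd] can matter only on the
    diagonal, where nothing is required. *)
Definition cyc_square (i j : 'I_n) : 'I_n := insubd i (cyc_add n i (o (cyc_sub n i j))).
Definition cyc_match (i : 'I_n) : 'I_n := insubd i (cyc_add n i z).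

Lemma val_cyc_square (i j : 'I_n) : i != j ->
  val (cyc_square i j) = cyc_add n i (o (cyc_sub n i j)).
Proof.
move=> ij; rewrite val_insubd; case: ifP => // /negP[]; apply: cyc_add_lt => //.
by case/andP: (o_bounds (cyc_sub_bounds (ltn_ord i) (ltn_ord j) ij)).
Qed.

Lemma val_cyc_match (i : 'I_n) : val (cyc_match i) = cyc_add n i z.
Proof.
rewrite val_insubd; case: ifP => // /negP[]; apply: cyc_add_lt => //.
by have := ltn_ord i; case: z_half; lia.
Qed.

Lemma cyc_match_fixed (i : 'I_n) : (cyc_match i == i) = (z == 0).
Proof.
rewrite -val_eqE val_cyc_match /= /cyc_add; have := ltn_ord i.
by case: ifP; case: z_half; lia.
Qed.

(** Rows are injective because [o] is, and avoid [i] because [o] avoids 0; [o_opp] is symmetry in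
    terms of differences. Matched pairs give the translates [i + o z], which are distinct. *)
Lemma cyc_matched_square : matched_square cyc_square cyc_match.
Proof.
have bnd (i j : 'I_n) : i != j -> 0 < cyc_sub n i j < n.
  by move=> ij; exact: (cyc_sub_bounds (ltn_ord i) (ltn_ord j) ij).
have obnd (i j : 'I_n) : i != j -> 0 < o (cyc_sub n i j) < n.
  by move/bnd/o_bounds.
have zn (i : 'I_n) : z < n by have := ltn_ord i; case: z_half; lia.
have sub_match (i : 'I_n) : cyc_sub n i (cyc_match i) = z.
  by rewrite val_cyc_match cyc_addK // (zn i).
split.
- move=> i; apply: val_inj; rewrite !val_cyc_match /= /cyc_add; have := ltn_ord i.
  by case: (ltnP (i + z) n); case: ifP; case: z_half; lia.
- move=> i j ij; rewrite -val_eqE val_cyc_square //= /cyc_add.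
  by have := ltn_ord i; have := obnd _ _ ij; case: ifP; lia.
- move=> i j j' ij ij' /(congr1 val); rewrite !val_cyc_square //.
  move/cyc_addI; rewrite ltn_ord; case/andP: (obnd _ _ ij) => _ ->.
  case/andP: (obnd _ _ ij') => _ -> /(_ isT isT isT)/o_inj.
  by rewrite !bnd // => /(_ isT isT)/cyc_subI E; apply: val_inj; exact: E.
- move=> i j ij jp; have ji : j != i by rewrite eq_sym.
  have dz : cyc_sub n i j != z.
    apply: contra jp => /eqP E; apply/eqP/val_inj; rewrite val_cyc_match -E.
    by rewrite cyc_subK.
  apply: val_inj; rewrite !val_cyc_square // (cyc_subC (ltn_ord i) (ltn_ord j) ij).
  have := o_opp (bnd _ _ ij) dz; have := obnd _ _ ij; have := obnd _ _ ji.
  have := bnd _ _ ij; rewrite (cyc_subC (ltn_ord i) (ltn_ord j) ij); have := cyc_subK (ltn_ord i) (ltn_ord j).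
  rewrite /cyc_add; move: (cyc_sub n i j) => d; have := ltn_ord i; have := ltn_ord j.
  by do 3!case: ifP; lia.
- move=> i j ip jp /(congr1 val); rewrite !val_cyc_square 1?eq_sym // !sub_match.
  move/cyc_addIr=> E; apply: val_inj; apply: E => //.
  have /o_bounds/andP[] // : 0 < z < n.
  by rewrite (zn i) lt0n -(cyc_match_fixed i) ip.
Qed.

End CyclicSquare.

Lemma odd_matched_square n : odd n ->
  exists f, @matched_square 'I_n f id.
Proof.
(* Here [o d] is half of [d] modulo the odd [n], so the square takes midpoints. *)
move=> on; pose o d := uphalf d + (if odd d then n./2 else 0).
have sq : matched_square (@cyc_square n o) (@cyc_match n 0).
  apply: cyc_matched_square; rewrite /o; first (by left); move=> d.
  - by case: ifP; lia.
  - by move=> d'; do 2!case: ifP; lia.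
  - by do 2!case: ifP; lia.
exists (@cyc_square n o); case: sq => _ f1 f2 f3 f4.
have m0 i : @cyc_match n 0 i = i by apply/eqP; rewrite cyc_match_fixed //; left.
split=> // i j; first by rewrite -{2}[i]m0; exact: f3.
by rewrite eqxx.
Qed.

Lemma even_matched_square n : ~~ odd n ->
  exists f p, @matched_square 'I_n f p /\ forall i, p i != i.
Proof.
move=> en; pose h := n./2.
(* The midpoint of the shorter arc between the two points if its length is even,
   a point next to the antipode of that midpoint if the length is odd. *)
pose o d := uphalf d + (if d == h then 0 else if odd d (+) (h < d) then h else 0).
have zh : h = 0 \/ h + h = n by lia.
exists (@cyc_square n o), (@cyc_match n h); split; last first.
  (* The element [i] excludes [n = 0], the only even order with [h = 0]. *)
  by move=> i; rewrite cyc_match_fixed //; have := ltn_ord i; lia.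
apply: cyc_matched_square => //; rewrite /o; move=> d.
- by do 2?case: ifP; lia.
- by move=> d'; do 4?case: ifP; lia.
- by do 4?case: ifP; lia.
Qed.

(** * Parity cases and the final bound *)

Lemma dprod_swap (G H : sgraph) : has_immersion (dprod G H) (dprod H G).
Proof.
apply: (@immersion_of_hom (dprod G H) (dprod H G) (fun u => (u.2, u.1))).
  by move=> [a b] [a' b'] [-> ->].
by move=> u v /andP[uv1 uv2]; apply/andP.
Qed.

Lemma ord_clique_product_immersion (s m : nat) :
  has_immersion (clique (option ('I_s * 'I_m)))
    (dprod (clique (option 'I_s)) (clique (option 'I_m))).
Proof.
have [om|em] := boolP (odd m).
  have [fM sqM] := odd_matched_square om.
  have [os|es] := boolP (odd s).
    have [fS sqS] := odd_matched_square os.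
    exact: (clique_product_immersion sqS sqM (e := false)).
  have [fS [pS [sqS _]]] := even_matched_square es.
  exact: (clique_product_immersion sqS sqM (e := false)).
have [fM [pM [sqM pMn]]] := even_matched_square em.
have [os|es] := boolP (odd s).
  have [fS sqS] := odd_matched_square os.
  (* With [e] false the second factor must carry the identity matching, so the odd order [s] is
     moved there. *)
  have swap : has_immersion (clique (option ('I_s * 'I_m))) (clique (option ('I_m * 'I_s))).
    apply: (@immersion_of_hom (clique _) (clique _) (omap (fun u => (u.2, u.1)))).
      by move=> [[a b]|] [[a' b']|] //= [-> ->].
    by move=> [[a b]|] [[a' b']|] //=; apply: contraNN => /eqP[-> ->].
  apply: has_immersion_trans swap (has_immersion_trans _ (dprod_swap _ _)).
  exact: (clique_product_immersion sqM sqS (e := false)).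
have [fS [pS [sqS pSn]]] := even_matched_square es.
exact: (clique_product_immersion sqS sqM (e := true)).
Qed.

Lemma complete_product_immersion (s m : nat) :
  has_immersion (complete (s * m).+1) (dprod (complete s.+1) (complete m.+1)).
Proof.
have cardT : #|{: option ('I_s * 'I_m)}| = (s * m).+1.
  by rewrite card_option card_prod !card_ord.
have cardO n : #|{: option 'I_n}| = n.+1 by rewrite card_option card_ord.
apply: (@has_immersion_trans _ (clique (option ('I_s * 'I_m)))).
  rewrite -cardT; apply: (@immersion_of_hom (complete _) (clique _) enum_val).
    exact: enum_val_inj.
  by move=> i j; rewrite /= /clique_rel (inj_eq enum_val_inj).
apply: has_immersion_trans (ord_clique_product_immersion s m) _.
rewrite -!cardO.
apply: (@immersion_of_hom (dprod (clique _) (clique _)) (dprod (complete _) (complete _))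
  (fun u => (enum_rank u.1, enum_rank u.2))).
  by move=> [a b] [a' b'] [/enum_rank_inj-> /enum_rank_inj->].
move=> [a b] [a' b']; rewrite /= /dprod_rel /= /complete_rel.
by rewrite !(inj_eq enum_rank_inj).
Qed.

Theorem theorem23 (G H : sgraph) (t r : nat)
  (G_nonempty : 0 < #|G|) (H_nonempty : 0 < #|H|)
  (imG : im G = t) (imH : im H = r)
  (I1 : immersion (complete t) G) (I2 : immersion (complete r) H)
  (same_parity : (all_even_pegs I1 /\ all_even_pegs I2) \/
                 (all_odd_pegs I1 /\ all_odd_pegs I2)) :
  (t - 1) * (r - 1) + 1 <= im (dprod G H).
Proof.
(* Positivity makes the truncated [t - 1] and [r - 1] true predecessors. *)
have t_gt0 : 0 < t by rewrite -imG im_gt0.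
have r_gt0 : 0 < r by rewrite -imH im_gt0.
apply: leq_im; apply: has_immersion_trans (dprod_has_immersion_pegs same_parity).
have := complete_product_immersion (t - 1) (r - 1).
by rewrite !subn1 !prednK // addn1.
Qed.
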